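(* Let $W=(W_1,\ldots,W_n)\in B(F^2(H_n))^n$ be the weighted left multi-shift associated with strictly positive weights $\boldsymbol\mu=\{\mu_\beta\}_{|\beta|\ge1}$. Then the following statements hold. (i) The joint point spectrum $\sigma_p(W_1^*,\ldots,W_n^* )$ coincides with the set $$\Big\{\lambda=(\lambda_1,\ldots,\lambda_n)\in\mathbb C^n:\ \sum_{\alpha\in\mathbb F_n^+}\frac{|\lambda_\alpha|^2}{\boldsymbol\mu(\alpha,g_0)^2}<\infty\Big\},$$ and the joint eigenvectors for $W_1^*,\ldots,W_n^*$ are precisely (up to nonzero scalar multiples) the vectors $$z_\lambda:=\sum_{\alpha\in\mathbb F_n^+}\frac{\bar\lambda_\alpha}{\boldsymbol\mu(\alpha,g_0)}e_\alpha,\qquad\lambda\in\sigma_p(W_1^*,\ldots,W_n^* ).$$ In this case, $W_i^*z_\lambda=\bar\lambda_iz_\lambda$ for $i\in\{1,\ldots,n\}$. (ii) $\sigma_p(W_1^*,\ldots,W_n^* )$ is a complete Reinhardt set in $\mathbb C^n$ containing the origin, and $$\sigma_p(W_1^*,\ldots,W_n^* )\subset\{(\lambda_1,\ldots,\lambda_n)\in\mathbb C^n:\ (|\lambda_1|^2+\cdots+|\lambda_n|^2)^{1/2}\le r(W)\}.$$ (iii) If $\lambda\in\mathbb C^n$ is such that $\|\lambda\|=\|W\|$, then $\lambda\notin\sigma_p(W_1^*,\ldots,W_n^* )$. (iv) $\sigma_p(W_1^*,\ldots,W_n^* )$ contains a ball (of positive radius) centered at zero if and only if $$\limsup_{k\to\infty}\Big(\sum_{|\alpha|=k}\frac1{\boldsymbol\mu(\alpha,g_0)^2}\Big)^{1/k}<\infty.$$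 In particular, the latter relation holds if the weights are bounded away from zero.
   Context: $\mathbb F_n^+$ is the unital free semigroup on generators $g_1,\ldots,g_n$ with identity $g_0$; $|\alpha|$ is the length of $\alpha$. $F^2(H_n)$ is the full Fock space, a Hilbert space with orthonormal basis $\{e_\alpha\}_{\alpha\in\mathbb F_n^+}$. The weights satisfy $\sup_\alpha\mu_{g_i\alpha}<\infty$ for each $i$ and $W_ie_\alpha:=\mu_{g_i\alpha}e_{g_i\alpha}$. For $\alpha=g_{i_1}\cdots g_{i_k}$: $\lambda_\alpha:=\lambda_{i_1}\cdots\lambda_{i_k}$, $W_\alpha:=W_{i_1}\cdots W_{i_k}$, $\boldsymbol\mu(\alpha,g_0):=\mu_{g_{i_1}\cdots g_{i_k}}\mu_{g_{i_2}\cdots g_{i_k}}\cdots\mu_{g_{i_k}}$; for $g_0$ these are $1$, $I$, $1$. The joint point spectrum $\sigma_p(W_1^*,\ldots,W_n^* )$ is the set of $\zeta\in\mathbb C^n$ for which there is $z\ne0$ (a joint eigenvector) with $W_i^*z=\zeta_iz$ for all $i$. $r(W):=\lim_k\|\sum_{|\alpha|=k}W_\alpha W_\alpha^*\|^{1/2k}$, $\|W\|:=\|\sum_iW_iW_i^*\|^{1/2}$, $\|\lambda\|$ is the Euclidean norm. A set $E\subset\mathbb C^n$ is complete Reinhardt if $\lambda\in E$ and $|\zeta_i|\le|\lambda_i|$ for all $i$ imply $\zeta\in E$. *)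

(* Defs.v *)
From HB Require Import structures.
From mathcomp Require Import all_boot all_order all_algebra finmap complex.
From mathcomp Require Import all_classical all_reals all_analysis.
From mathcomp Require summability.
Set Implicit Arguments.
Unset Strict Implicit.
Unset Printing Implicit Defensive.
Import Order.TTheory GRing.Theory Num.Theory.
Import numFieldNormedType.Exports.
Local Open Scope classical_set_scope.
Local Open Scope complex_scope.
Local Open Scope ring_scope.

(* Complex Hilbert spaces. The norm of a normed module over [R[i]] takes its
   values in [R[i]]. The inner product is linear in its first argument and
   conjugate-linear in the second one. *)
HB.mixin Record CompleteNormedModule_isHilbert (R : realType) H
    & CompleteNormedModule R[i] H := {
  inner : {dot H for (@Num.conj R[i])} ;
  inner_norm : forall x : H, `|x| ^+ 2 = inner x x
}.

#[short(type="hilbertType")]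
HB.structure Definition Hilbert (R : realType) :=
  {H of CompleteNormedModule R[i] H & CompleteNormedModule_isHilbert R H}.

(* The real-valued norm, for scalars as well as for vectors. *)
Definition rnorm (R : realType) (V : normedZmodType R[i]) (v : V) : R :=
  complex.Re `|v|.

Section operators.
Context {R : realType} {H : hilbertType R}.
Local Notation C := R[i].
Implicit Types (T : H -> H) (x y z : H).

Definition orthonormal_basis (I : choiceType) (e : I -> H) : Prop :=
  (forall a b : I, inner (e a) (e b) = (a == b)%:R) /\
  (forall x, (forall a, inner x (e a) = 0) -> x = 0).

Definition bounded_op T : Prop :=
  exists M : R, forall x, rnorm (T x) <= M * rnorm x.

Definition opnorm T : R :=
  sup [set rnorm (T x) | x in [set x | rnorm x <= 1]].

Definition adjoint T : H -> H :=
  fun y => get [set z | forall x, inner (T x) y = inner x z].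

Section tuples.
Variable n : nat.
Implicit Types (S W : 'I_n -> H -> H) (zeta : 'rV[C]_n).

Definition joint_eigenvector_at S zeta z : Prop :=
  z != 0 /\ forall i, S i z = zeta 0 i *: z.

Definition joint_eigenvector S z : Prop :=
  exists zeta, joint_eigenvector_at S zeta z.

Definition joint_point_spectrum S : set 'rV[C]_n :=
  [set zeta | exists z, joint_eigenvector_at S zeta z].

Definition word_op W (a : seq 'I_n) : H -> H :=
  foldr (fun i T => W i \o T) idfun a.

Definition row_norm W : R :=
  Num.sqrt (opnorm (fun x => \sum_(i < n) W i (adjoint (W i) x))).

Definition joint_spectral_radius W : R :=
  limn (fun k : nat =>
    opnorm (fun x =>
      \sum_(a : k.-tuple 'I_n) word_op W a (adjoint (word_op W a) x))
    `^ ((2 * k)%:R^-1)).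

End tuples.
End operators.

Section weights.
Context {R : realType} {n : nat}.
Local Notation C := R[i].
Implicit Types (mu : seq 'I_n -> R) (lam : 'rV[C]_n) (a : seq 'I_n).

(* A word [g_{i1} ... g_{ik}] of the free semigroup is the sequence
   [:: i1; ...; ik]; the value of [mu] at the empty word is never used. *)
Fixpoint weight_prod mu a : R :=
  if a is i :: b then mu a * weight_prod mu b else 1.

Definition word_eval lam a : C := \prod_(i <- a) lam 0 i.

Definition enorm lam : R := Num.sqrt (\sum_(i < n) rnorm (lam 0 i) ^+ 2).

Definition complete_Reinhardt (E : set 'rV[C]_n) : Prop :=
  forall lam (zeta : 'rV[C]_n), E lam ->
    (forall i, rnorm (zeta 0 i) <= rnorm (lam 0 i)) -> E zeta.

Definition weight_growth mu : \bar R :=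
  limn_esup (fun k : nat =>
    ((\sum_(a : k.-tuple 'I_n) (weight_prod mu a ^+ 2)^-1) `^ (k%:R^-1))%:E).

Definition weighted_shift (H : hilbertType R) (e : seq 'I_n -> H) mu
    (W : 'I_n -> {linear H -> H}) : Prop :=
  (forall i, bounded_op (W i)) /\
  (forall i a, W i (e a) = (mu (i :: a))%:C *: e (i :: a)).

Definition eigenseries (H : hilbertType R) (e : seq 'I_n -> H) mu lam a : H :=
  (Num.conj (word_eval lam a) / (weight_prod mu a)%:C) *: e a.

(* Sum of the family [eigenseries], along the finite sets of words. *)
Definition eigenvec (H : hilbertType R) (e : seq 'I_n -> H) mu lam : H :=
  summability.sum (eigenseries e mu lam).

End weights.

(* Main.v *)
(* Write z_a for the coefficient of z on e_a. Since W_i^* z has b-coefficient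
   mu(g_i b) z_(g_i b), the equations W_i^* z = zeta_i z say that
   z_a = zeta_a z_0 / mu(a, g_0) for every word a, so a joint eigenvector exists
   exactly when these coefficients are square summable (Riesz-Fischer).

   The operators sum_(|a| = k) W_a W_a^* are diagonal, the entry at b being the
   square of the product of the k weights met when b loses its first k letters.
   Hence their norms are the suprema s_k of these entries, s_(k+l) <= s_k s_l, and
   Fekete's lemma gives the existence of the limit r(W). Testing on an
   eigenvector gives ||lambda||^(2k) <= s_k. For (iii) and (iv) the square sum is
   taken level by level, using that the |lambda_a|^2 with |a| = k add up to
   ||lambda||^(2k). *)
Require Import Defs.
From HB Require Import structures.
From mathcomp Require Import all_boot all_order all_algebra finmap complex.
From mathcomp Require Import all_classical all_reals all_analysis.
From mathcomp Require summability.
From mathcomp Require Import ring.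
Set Implicit Arguments.
Unset Strict Implicit.
Unset Printing Implicit Defensive.
Import Order.TTheory GRing.Theory Num.Theory.
Import numFieldNormedType.Exports.
Local Open Scope classical_set_scope.
Local Open Scope complex_scope.
Local Open Scope ring_scope.

(** * Real-valued norms over the complex scalars *)

Section rnorm.
Context {R : realType} {V : normedModType R[i]}.
Implicit Types (x y : V) (a : R[i]).

Lemma rnormE (U : normedZmodType R[i]) (x : U) : `|x| = (rnorm x)%:C.
Proof. by rewrite /rnorm RRe_real// normr_real. Qed.

Lemma rnorm_ge0 (U : normedZmodType R[i]) (x : U) : 0 <= rnorm x.
Proof. by rewrite -ler0c -rnormE normr_ge0. Qed.

Lemma rnorm0 (U : normedZmodType R[i]) : rnorm (0 : U) = 0.
Proof. by rewrite /rnorm normr0. Qed.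

Lemma rnormN (U : normedZmodType R[i]) (x : U) : rnorm (- x) = rnorm x.
Proof. by rewrite /rnorm normrN. Qed.

Lemma rnorm_eq0 (U : normedZmodType R[i]) (x : U) : (rnorm x == 0) = (x == 0).
Proof. by rewrite -(inj_eq (@complexI R)) -rnormE normr_eq0. Qed.

Lemma rnorm_gt0 (U : normedZmodType R[i]) (x : U) : (0 < rnorm x) = (x != 0).
Proof. by rewrite lt_def rnorm_eq0 rnorm_ge0 andbT. Qed.

Lemma ler_rnormD (U : normedZmodType R[i]) (x y : U) :
  rnorm (x + y) <= rnorm x + rnorm y.
Proof. by rewrite -lecR rmorphD/= -!rnormE ler_normD. Qed.

Lemma rnormZ a x : rnorm (a *: x) = rnorm a * rnorm x.
Proof. by apply: complexI; rewrite rmorphM/= -!rnormE normrZ. Qed.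

Lemma rnormM a (b : R[i]) : rnorm (a * b) = rnorm a * rnorm b.
Proof. by apply: complexI; rewrite rmorphM/= -!rnormE normrM. Qed.

Lemma rnormV a : rnorm a^-1 = (rnorm a)^-1.
Proof. by apply: complexI; rewrite fmorphV/= -!rnormE normfV. Qed.

Lemma rnormJ a : rnorm (Num.conj a) = rnorm a.
Proof. by apply: complexI; rewrite -!rnormE norm_conjC. Qed.

Lemma rnormC (r : R) : rnorm r%:C = `|r|.
Proof. by apply: complexI; rewrite -rnormE normc_def /= expr0n/= addr0 sqrtr_sqr. Qed.

Lemma conjC_real (r : R) : Num.conj r%:C = r%:C.
Proof. by apply: CrealP; apply/complex_realP; exists r. Qed.

Lemma rnorm_prod I (s : seq I) (f : I -> R[i]) :
  rnorm (\prod_(i <- s) f i) = \prod_(i <- s) rnorm (f i).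
Proof.
elim: s => [|i s IH]; first by rewrite !big_nil (rnormC 1) normr1.
by rewrite !big_cons rnormM IH.
Qed.

Lemma mulJ_rnorm a : a * Num.conj a = (rnorm a ^+ 2)%:C.
Proof. by rewrite -normCK rnormE rmorphXn. Qed.

End rnorm.

(** * Inner products and the Cauchy-Schwarz inequality *)

Section inner_product.
Context {R : realType} {H : hilbertType R}.
Implicit Types (x y z : H) (a : R[i]).

Lemma innerDl x y z : inner (x + y) z = inner x z + inner y z.
Proof. exact: linearDl. Qed.

Lemma innerBl x y z : inner (x - y) z = inner x z - inner y z.
Proof. exact: linearBl. Qed.

Lemma innerBr x y z : inner x (y - z) = inner x y - inner x z.
Proof. exact: linearBr. Qed.

Lemma inner0l x : inner 0 x = 0. Proof. exact: linear0l. Qed.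

Lemma innerZl a x y : inner (a *: x) y = a * inner x y.
Proof. exact: linearZl_LR. Qed.

Lemma innerZr a x y : inner x (a *: y) = Num.conj a * inner x y.
Proof. exact: linearZr_LR. Qed.

Lemma inner_suml I (s : seq I) (P : pred I) (f : I -> H) y :
  inner (\sum_(i <- s | P i) f i) y = \sum_(i <- s | P i) inner (f i) y.
Proof. exact: linear_sumlz. Qed.

Lemma inner_sumr I (s : seq I) (P : pred I) (f : I -> H) x :
  inner x (\sum_(i <- s | P i) f i) = \sum_(i <- s | P i) inner x (f i).
Proof. exact: linear_sumr. Qed.

Lemma innerC x y : inner y x = Num.conj (inner x y).
Proof. by rewrite hermC expr0 mul1r. Qed.

Lemma inner_rnorm x : inner x x = (rnorm x ^+ 2)%:C.
Proof. by rewrite -inner_norm rnormE rmorphXn. Qed.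

Lemma inner_ext x y : (forall z, inner z x = inner z y) -> x = y.
Proof.
move=> xy; apply/eqP; rewrite -subr_eq0 -rnorm_eq0 -sqrf_eq0.
by rewrite -(inj_eq (@complexI R)) -inner_rnorm innerBr xy subrr.
Qed.

(* |y|^2 |x|^2 - |<x,y>|^2 is |y|^2 times the squared distance from x to the
   line spanned by y. *)
Lemma cauchy_schwarz x y : rnorm (inner x y) <= rnorm x * rnorm y.
Proof.
have [->|y0] := eqVneq y 0.
  by rewrite (innerC 0) inner0l rmorph0 !rnorm0 mulr0.
have ny : 0 < rnorm y by rewrite rnorm_gt0.
rewrite -(@ler_pXn2r _ 2)// ?nnegrE ?mulr_ge0 ?rnorm_ge0// exprMn.
pose c := inner x y / (rnorm y ^+ 2)%:C.
have nC : (rnorm y ^+ 2)%:C != 0 :> R[i].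
  by rewrite (fmorph_eq0 (real_complex R)) sqrf_eq0 rnorm_eq0.
have E : inner (x - c *: y) (x - c *: y) =
    (rnorm x ^+ 2 - rnorm (inner x y) ^+ 2 / rnorm y ^+ 2)%:C.
  rewrite innerBr innerZr (_ : inner (x - c *: y) y = 0) ?mulr0 ?subr0.
    rewrite innerBl innerZl !inner_rnorm (innerC x y) /c mulrAC mulJ_rnorm.
    by rewrite [RHS]rmorphB/= (fmorph_div (real_complex R)).
  by rewrite innerBl innerZl inner_rnorm divfK// subrr.
move: E; rewrite inner_rnorm => /complexI E.
have := sqr_ge0 (rnorm (x - c *: y)); rewrite E subr_ge0 ler_pdivrMr//.
by rewrite exprn_gt0.
Qed.

End inner_product.

Lemma partial_sumE (I : choiceType) (V : zmodType) (x : I -> V) (A : {fset I}) :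
  summability.partial_sum x A = \sum_(a <- A) x a.
Proof. by rewrite /summability.partial_sum big_seq_fsetE. Qed.

Lemma big_fset_subset (I : choiceType) (V : nmodType) (f : I -> V)
    (A B : {fset I}) : (A `<=` B)%fset ->
  \sum_(a <- B) f a = \sum_(a <- A) f a + \sum_(a <- (B `\` A)%fset) f a.
Proof.
move=> AB; rewrite -big_cat/=; apply/perm_big/uniq_perm.
- exact: fset_uniq.
- rewrite cat_uniq !fset_uniq/= andbT; apply/hasPn => a.
  by rewrite in_fsetD => /andP[].
- move=> a; rewrite mem_cat in_fsetD; have [aA|//] := boolP (a \in A).
  by rewrite (fsubsetP AB).
Qed.

(** Identities involving infinite sums are proved by approximation within every [r > 0]. *)
Lemma eq_of_rnorm_lt (R : realType) (V : normedZmodType R[i]) (x y : V) :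
  (forall r : R, 0 < r -> rnorm (x - y) < r) -> x = y.
Proof.
move=> xy; apply/eqP; rewrite -subr_eq0 -rnorm_eq0 -[_ == _]negbK.
apply/negP => xy0; have := xy (rnorm (x - y)); rewrite ltxx => /(_ _)/negP[]//.
by rewrite rnorm_gt0 -rnorm_eq0.
Qed.

(** * Orthonormal expansions and adjoints of bounded operators *)

Section basis.
Context {R : realType} {H : hilbertType R} {I : choiceType} {e : I -> H}.
Hypothesis he : orthonormal_basis e.
Implicit Types (x y z : H) (c : I -> R[i]) (A B : {fset I}).

Lemma coef_basis a b : inner (e a) (e b) = (a == b)%:R.
Proof. exact: he.1. Qed.

Lemma rnorm_basis a : rnorm (e a) = 1.
Proof.
have := inner_rnorm (e a); rewrite coef_basis eqxx => /complexI/esym/eqP.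
by rewrite sqrp_eq1 ?rnorm_ge0// => /eqP.
Qed.

Lemma coef_sum A c b :
  inner (\sum_(a <- A) c a *: e a) (e b) = if b \in A then c b else 0.
Proof.
rewrite inner_suml; under eq_bigr do rewrite innerZl coef_basis.
case: ifPn => bA.
  rewrite (big_fsetD1 b)//= eqxx mulr1 big_seq big1 ?addr0// => a.
  by rewrite in_fsetD1 => /andP[/negbTE ->]; rewrite mulr0.
rewrite big_seq big1// => a aA; have [ab|] := eqVneq a b; last by rewrite mulr0.
by rewrite -ab aA in bA.
Qed.

Lemma pythagoras A c :
  rnorm (\sum_(a <- A) c a *: e a) ^+ 2 = \sum_(a <- A) rnorm (c a) ^+ 2.
Proof.
apply: complexI; rewrite -inner_rnorm inner_sumr rmorph_sum/=.
apply: eq_big_seq => a aA; rewrite innerZr coef_sum aA mulrC.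
exact: mulJ_rnorm.
Qed.

(** The partial expansion [s] is the orthogonal projection of [x], so the two sides differ by the
    squared norm of [x - s]. *)
Lemma bessel A x : \sum_(a <- A) rnorm (inner x (e a)) ^+ 2 <= rnorm x ^+ 2.
Proof.
set c := fun a => inner x (e a); set s := \sum_(a <- A) c a *: e a.
have xs : inner (x - s) s = 0.
  rewrite inner_sumr big_seq big1// => a aA.
  by rewrite innerZr innerBl coef_sum aA subrr mulr0.
have sx : inner s x = (\sum_(a <- A) rnorm (c a) ^+ 2)%:C.
  rewrite inner_suml rmorph_sum/=; apply: eq_bigr => a _.
  by rewrite innerZl (innerC x) mulJ_rnorm.
have := inner_rnorm (x - s); rewrite innerBr xs subr0 innerBl sx inner_rnorm.
by rewrite -rmorphB => /complexI E; rewrite -subr_ge0 E sqr_ge0.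
Qed.

Lemma coef_inj x y : (forall a, inner x (e a) = inner y (e a)) -> x = y.
Proof.
move=> xy; apply/eqP; rewrite -subr_eq0; apply/eqP/he.2 => a.
by rewrite innerBl xy subrr.
Qed.

(** Summability is encoded as a common bound for the finite sums, the form in which Bessel's
    inequality delivers it. *)
Definition square_summable c :=
  exists M : R, forall A, \sum_(a <- A) rnorm (c a) ^+ 2 <= M.

(** Completeness reduces this to a Cauchy property: once the square sum over [A] is within [r ^+ 2]
    of its supremum, enlarging [A] adds less than [r ^+ 2], and by Pythagoras the vector moves by
    less than [r]. *)
Lemma riesz_fischer c : square_summable c ->
  cvg (summability.partial_sum (fun a => c a *: e a) @ summability.totally).
Proof.
have tF := @summability.totally_filter I.
move=> [M cM]; apply/cauchy_cvgP/cauchy_exP => eps eps0.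
(* Radii live in [R[i]]; a positive one is real. *)
have [r -> r0] : exists2 r : R, eps = r%:C & 0 < r.
  have /complex_realP[r E] : eps \is Num.real by rewrite gtr0_real.
  by exists r => //; rewrite -ltcR -E.
pose f A := \sum_(a <- A) rnorm (c a) ^+ 2.
have hs : has_sup (range f).
  by split; [exists (f fset0), fset0|exists M => _ [A _ <-]; exact: cM].
have [_ [A _ <-] fA] := sup_adherent (exprn_gt0 2 r0) hs.
exists (summability.partial_sum (fun a => c a *: e a) A), A => // B /= AB.
rewrite -ball_normE/= !partial_sumE distrC (big_fset_subset _ AB) addrC addKr.
rewrite rnormE ltcR -(@ltr_pXn2r _ 2)// ?nnegrE ?rnorm_ge0 ?(ltW r0)//.
rewrite pythagoras.
have : f B <= sup (range f) by apply: ub_le_sup; [exact: hs.2|exists B].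
rewrite /f (big_fset_subset _ AB) -/(f A) => fB.
by rewrite -(ltrD2l (f A)) (le_lt_trans fB)// -ltrBlDr.
Qed.

Definition basis_sum c : H := summability.sum (fun a => c a *: e a).

(** Prescribing [A] lets a given index be forced into the approximating set. *)
Lemma basis_sum_approx c A (r : R) : square_summable c -> 0 < r ->
  exists2 B, (A `<=` B)%fset & rnorm (basis_sum c - \sum_(a <- B) c a *: e a) < r.
Proof.
have tF := @summability.totally_filter I.
move=> /riesz_fischer cc r0; have := cc => /cvgrPdist_lt/(_ r%:C).
rewrite -[0]/(0%:C) ltcR => /(_ r0)[B _ Br]; exists (A `|` B)%fset.
  exact: fsubsetUl.
rewrite -ltcR -rnormE -partial_sumE; apply: Br => /=; exact: fsubsetUr.
Qed.

(** A finite sum whose index set contains [b] already has the right coefficient, and Cauchy-Schwarz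
    carries this to the limit. *)
Lemma coef_basis_sum c b : square_summable c -> inner (basis_sum c) (e b) = c b.
Proof.
move=> cs; apply: eq_of_rnorm_lt => r r0.
have [B bB Br] := basis_sum_approx [fset b]%fset cs r0.
apply: le_lt_trans Br; rewrite fsub1set in bB.
rewrite -[leRHS]mulr1 -(rnorm_basis b).
by rewrite (le_trans _ (cauchy_schwarz _ _))// innerBl coef_sum bB.
Qed.

Lemma square_summable_coef x : square_summable (fun a => inner x (e a)).
Proof. by exists (rnorm x ^+ 2) => A; exact: bessel. Qed.

Lemma basis_expansion x : basis_sum (fun a => inner x (e a)) = x.
Proof.
apply: coef_inj => b; rewrite coef_basis_sum//.
exact: square_summable_coef.
Qed.

Lemma basis_approx x (r : R) : 0 < r ->
  exists A, rnorm (x - \sum_(a <- A) inner x (e a) *: e a) < r.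
Proof.
move=> r0; have [A _] := basis_sum_approx fset0 (square_summable_coef x) r0.
by rewrite basis_expansion; exists A.
Qed.

(** Converse of Bessel's inequality: up to [r], the vector is a finite expansion, whose norm
    Pythagoras bounds by [M]. *)
Lemma rnorm_le_coef x (M : R) : 0 <= M ->
  (forall A, \sum_(a <- A) rnorm (inner x (e a)) ^+ 2 <= M ^+ 2) -> rnorm x <= M.
Proof.
move=> M0 xM; apply/ler_addgt0Pr => r r0.
have [A Ar] := basis_approx x r0.
rewrite -[x](subrK (\sum_(a <- A) inner x (e a) *: e a)) addrC.
rewrite (le_trans (ler_rnormD _ _))// lerD ?(ltW Ar)//.
by rewrite -(@ler_pXn2r _ 2)// ?nnegrE ?rnorm_ge0// pythagoras.
Qed.

Lemma square_summable_sub c c' : (forall a, rnorm (c a) <= rnorm (c' a)) ->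
  square_summable c' -> square_summable c.
Proof.
move=> cc' [M c'M]; exists M => A; apply: le_trans (c'M A).
by apply: ler_sum => a _; rewrite ler_pXn2r// nnegrE rnorm_ge0.
Qed.

Definition is_adjoint (T S : H -> H) := forall x y, inner (T x) y = inner x (S y).

(** Since [adjoint] picks its values by choice, [S] serves as proof that they exist; nondegeneracy
    of the inner product makes them unique. *)
Lemma adjointE T S : is_adjoint T S -> adjoint T = S.
Proof.
move=> TS; apply/funext => y; apply: inner_ext => z.
have E : [set w | forall x, inner (T x) y = inner x w] (adjoint T y).
  by apply: getPex; exists (S y) => x; exact: TS.
by rewrite -TS E.
Qed.

(* The adjoint at y is the vector with coefficients <y, T e_a>; testing T on the
   finite partial sums bounds their square sum by M^2 |y|^2. *)
Lemma bounded_adjoint (T : {linear H -> H}) : bounded_op T ->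
  is_adjoint T (adjoint T).
Proof.
move=> [M TM].
have M0 : 0 <= Num.max M 0 by rewrite le_max lexx orbT.
have {}TM x : rnorm (T x) <= Num.max M 0 * rnorm x.
  by rewrite (le_trans (TM x))// ler_wpM2r ?rnorm_ge0// le_max lexx.
move: (Num.max M 0) M0 TM => {}M M0 TM.
pose c y a := inner y (T (e a)).
have Tsum A d y : inner (T (\sum_(a <- A) d a *: e a)) y =
    \sum_(a <- A) d a * Num.conj (c y a).
  rewrite linear_sum inner_suml; apply: eq_bigr => a _.
  by rewrite linearZ/= innerZl (innerC y).
have cs y : square_summable (c y).
  exists ((M * rnorm y) ^+ 2) => A; set S := \sum_(a <- A) _.
  have S0 : 0 <= S by apply: sumr_ge0 => a _; rewrite sqr_ge0.
  (* For this test vector both [<T s, y>] and [|s|^2] equal [S], so [|s|^2 <= M |y| |s|] and one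
     factor [|s|] cancels. *)
  pose s := \sum_(a <- A) c y a *: e a.
  have sS : rnorm s ^+ 2 = S by rewrite pythagoras.
  have SE : inner (T s) y = S%:C.
    by rewrite Tsum rmorph_sum/=; apply: eq_bigr => a _; rewrite mulJ_rnorm.
  have : S <= M * rnorm y * rnorm s.
    rewrite -[leLHS]ger0_norm// -rnormC -SE mulrAC.
    by rewrite (le_trans (cauchy_schwarz _ _))// ler_wpM2r ?rnorm_ge0.
  rewrite -sS expr2; have [->|s0] := eqVneq (rnorm s) 0.
    by rewrite mulr0 sqr_ge0.
  rewrite ler_pM2r ?lt_def ?s0 ?rnorm_ge0// => sM.
  by rewrite -expr2 ler_pXn2r// nnegrE ?mulr_ge0 ?rnorm_ge0.
suff TS : is_adjoint T (fun y => basis_sum (c y)) by rewrite (adjointE TS).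
move=> x y; apply: eq_of_rnorm_lt => r r0.
(* The two sides agree on finite expansions [s], and on [x - s] they differ by at most [K |x - s|].
   Approximating within [r / (K + 1)] avoids a division by zero. *)
pose K := M * rnorm y + rnorm (basis_sum (c y)).
have K0 : 0 <= K by rewrite addr_ge0 ?mulr_ge0 ?rnorm_ge0.
have [A Ar] := basis_approx x (divr_gt0 r0 (ltr_wpDl K0 ltr01)).
set s := \sum_(a <- A) _ in Ar.
have sE : inner (T s) y = inner s (basis_sum (c y)).
  rewrite Tsum inner_suml; apply: eq_bigr => a _.
  by rewrite innerZl (innerC (basis_sum _)) coef_basis_sum.
rewrite -[x](subrK s) linearD !innerDl sE opprD addrACA subrr addr0.
rewrite (le_lt_trans (ler_rnormD _ _))// rnormN.
apply: (@le_lt_trans _ _ (K * rnorm (x - s))).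
  rewrite mulrDl lerD//.
    rewrite (le_trans (cauchy_schwarz _ _))// mulrAC.
    by rewrite ler_wpM2r ?rnorm_ge0.
  by rewrite -innerDl (le_trans (cauchy_schwarz _ _))// mulrC.
rewrite (@le_lt_trans _ _ ((K + 1) * rnorm (x - s)))//.
  by rewrite ler_wpM2r ?rnorm_ge0// lerDl.
by rewrite mulrC -ltr_pdivlMr// ltr_wpDl.
Qed.

(** * Operators that are diagonal in the basis *)

Section diagonal.
Variables (T : H -> H) (d : I -> R) (D : R).
Hypothesis d0 : forall a, 0 <= d a.
Hypothesis dD : forall a, d a <= D.
Hypothesis Td : forall x a, inner (T x) (e a) = (d a)%:C * inner x (e a).

Lemma diagonal_has_ubound : has_ubound (range d).
Proof. by exists D => _ [a _ <-]. Qed.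

Lemma diagonal_le_sup a : d a <= sup (range d).
Proof. by apply: ub_le_sup; [exact: diagonal_has_ubound|exists a]. Qed.

Lemma diagonal_bound x : rnorm (T x) <= sup (range d) * rnorm x.
Proof.
have s0 : 0 <= sup (range d).
  (* Over an empty index type the range is empty and its [sup] is 0 by convention. *)
  have [[? [a _ _]]|] := pselect (range d !=set0).
    exact: le_trans (d0 a) (diagonal_le_sup a).
  by move=> dn; rewrite sup_out// => -[].
apply: rnorm_le_coef => [|A]; first by rewrite mulr_ge0 ?rnorm_ge0.
rewrite exprMn (le_trans _ (ler_wpM2l (sqr_ge0 _) (bessel A x)))// mulr_sumr.
apply: ler_sum => a _; rewrite Td rnormM rnormC exprMn ler_wpM2r ?sqr_ge0//.
by rewrite ger0_norm// ler_pXn2r ?nnegrE// diagonal_le_sup.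
Qed.

(** Each basis vector is an eigenvector for its diagonal entry, which gives the lower bound;
    [diagonal_bound] gives the upper one. The index [a0] makes the set of entries nonempty. *)
Lemma diagonal_opnorm (a0 : I) : opnorm T = sup (range d).
Proof.
have Te a : T (e a) = (d a)%:C *: e a.
  apply: coef_inj => b; rewrite Td innerZl coef_basis.
  by have [->|] := eqVneq a b; rewrite ?mulr0.
have s0 : 0 <= sup (range d) by exact: le_trans (d0 a0) (diagonal_le_sup a0).
have ub x : rnorm x <= 1 -> rnorm (T x) <= sup (range d).
  by move=> x1; rewrite (le_trans (diagonal_bound x))// ler_piMr.
apply/eqP; rewrite eq_le; apply/andP; split.
  apply: ge_sup; last by move=> _ [x /= x1 <-]; exact: ub.
  by exists (rnorm (T (e a0))), (e a0); rewrite //= rnorm_basis.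
apply: ge_sup; first by exists (d a0), a0.
move=> _ [a _ <-]; apply: ub_le_sup.
  by exists (sup (range d)) => _ [x /= x1 <-]; exact: ub.
exists (e a); first by rewrite /= rnorm_basis.
by rewrite Te rnormZ rnorm_basis mulr1 rnormC ger0_norm.
Qed.

End diagonal.
End basis.

(** * Sums, roots, limsup and Fekete's lemma over the reals *)

Section real_analysis.
Context {R : realType}.

(** Connects the extended sum in part (i) with the finite bounds of [square_summable]. *)
Lemma esum_ltyP (I : choiceType) (f : I -> R) : (forall a, 0 <= f a) ->
  (\esum_(a in [set: I]) (f a)%:E < +oo)%E <->
  exists M : R, forall A : {fset I}, \sum_(a <- A) f a <= M.
Proof.
move=> f0; split=> [flty|[M fM]].
  have fin : (\esum_(a in [set: I]) (f a)%:E)%E \is a fin_num.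
    by rewrite ge0_fin_numE// esum_ge0// => a _; rewrite lee_fin.
  exists (fine (\esum_(a in [set: I]) (f a)%:E)%E) => A.
  rewrite -lee_fin fineK// -sumEFin; apply: ereal_sup_ubound.
  exists [set` A]; first by split => //; exact: finite_fset.
  by rewrite fsbig_finite//= set_fsetK.
apply: le_lt_trans (ltry M); apply: ge_ereal_sup => _ [X [finX _] <-].
by rewrite fsbig_finite//= sumEFin lee_fin.
Qed.

Lemma root_le (x t : R) k : 0 <= x -> 0 <= t -> (0 < k)%N ->
  (x `^ k%:R^-1 <= t) = (x <= t ^+ k).
Proof.
move=> x0 t0 k0; have E : (x `^ k%:R^-1) ^+ k = x.
  by rewrite -powR_mulrn ?powR_ge0// -powRrM mulVf ?powRr1// pnatr_eq0 -lt0n.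
by rewrite -{2}E ler_pXn2r// nnegrE powR_ge0.
Qed.

Lemma root_expr (x : R) k : 0 <= x -> (0 < k)%N -> (x ^+ k) `^ k%:R^-1 = x.
Proof.
move=> x0 k0; rewrite -powR_mulrn// -powRrM mulfV ?powRr1//.
by rewrite pnatr_eq0 -lt0n.
Qed.

(** The limsup is an infimum of suprema over neighbourhoods of infinity, so one of these suprema is
    finite. *)
Lemma limn_esup_lty (u : nat -> R) : (limn_esup (fun k => (u k)%:E) < +oo)%E ->
  exists (L : R) (N : nat), forall k, (N <= k)%N -> u k <= L.
Proof.
move=> /ereal_inf_lt[_ [V [N _ NV] <-] Vlty].
have VE k : (N <= k)%N -> ((u k)%:E <= ereal_sup [set (u x)%:E | x in V])%E.
  by move=> Nk; apply: ereal_sup_ubound; exists k => //; exact: NV.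
have fin : ereal_sup [set (u x)%:E | x in V] \is a fin_num.
  by rewrite fin_numElt Vlty andbT (lt_le_trans (ltNyr (u N)))// VE.
exists (fine (ereal_sup [set (u x)%:E | x in V])), N => k Nk.
by rewrite -lee_fin fineK// VE.
Qed.

Lemma limn_esup_le (u : nat -> R) (L : R) : (forall k, u k <= L) ->
  (limn_esup (fun k => (u k)%:E) < +oo)%E.
Proof.
move=> uL; apply: le_lt_trans (ltry L); apply: ereal_inf_le.
exists (ereal_sup [set (u x)%:E | x in setT]).
  by exists setT => //; exact: filterT.
by apply: ge_ereal_sup => _ [k _ <-]; rewrite lee_fin.
Qed.

Lemma submultiplicative_iter (q : nat -> R) m j r : (forall k, 0 <= q k) ->
  (forall k l, q (k + l)%N <= q k * q l) -> q (j * m + r)%N <= q m ^+ j * q r.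
Proof.
move=> q0 qM; elim: j => [|j IH]; first by rewrite expr0 mul1r.
rewrite mulSn -addnA (le_trans (qM _ _))// exprS -mulrA.
by rewrite ler_wpM2l.
Qed.

(* Fekete's lemma: the k-th roots converge to the infimum of those with k >= 1. *)
Lemma submultiplicative_root_cvg (q : nat -> R) : (forall k, 0 <= q k) ->
  (forall k l, q (k + l)%N <= q k * q l) -> cvgn (fun k => q k `^ k%:R^-1).
Proof.
move=> q0 qM; pose E := [set q k `^ k%:R^-1 | k in [set k | (0 < k)%N]].
have Elb : has_lbound E by exists 0 => _ [k _ <-]; exact: powR_ge0.
have hE : has_inf E by split => //; exists (q 1%N `^ 1%:R^-1), 1%N.
have L0 : 0 <= inf E.
  by apply: lb_le_inf; [exact: hE.1|move=> _ [k _ <-]; exact: powR_ge0].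
apply/cvg_ex; exists (inf E); apply/cvgrPdist_le => eps eps0.
have eps20 : 0 < eps / 2 by rewrite divr_gt0.
have [_ [m /= m0 <-] mlt] := inf_adherent eps20 hE.
set t := inf E + eps / 2 in mlt; have t0 : 0 < t by rewrite ltr_wpDl.
have qm : q m <= t ^+ m by rewrite -root_le// ?ltW.
(* Dividing [k] by [m] leaves a factor [q r] with [r < m]; as [q r / t ^+ r] is a summand of [C],
   this factor is at most [C * t ^+ r]. *)
pose C := 1 + \sum_(r < m) q r / t ^+ r.
have C0 : 0 < C.
  by rewrite ltr_wpDr// sumr_ge0// => r _; rewrite divr_ge0// exprn_ge0// ltW.
have qC k : q k <= C * t ^+ k.
  rewrite {1}(divn_eq k m) (le_trans (submultiplicative_iter _ _ _ q0 qM))//.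
  apply: (@le_trans _ _ ((t ^+ m) ^+ (k %/ m) * (C * t ^+ (k %% m)))).
    apply: ler_pM => //; first by rewrite exprn_ge0.
      by rewrite lerXn2r ?nnegrE ?exprn_ge0// ltW.
    rewrite -ler_pdivrMr ?exprn_gt0// /C (bigD1 (Ordinal (ltn_pmod k m0)))//=.
    rewrite addrCA lerDl addr_ge0// sumr_ge0// => r _.
    by rewrite divr_ge0// exprn_ge0// ltW.
  by rewrite mulrCA ler_wpM2l ?(ltW C0)// -exprM -exprD mulnC -divn_eq.
(* The gap between [t] and [s] absorbs [C]: eventually [(t / s) ^+ k <= C^-1], hence
   [q k <= C * t ^+ k <= s ^+ k]. *)
pose s := inf E + eps; have ts : t < s.
  by rewrite ltrD2l gtr_pMr// invf_lt1// ltr1n.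
have s0 : 0 < s by exact: lt_trans ts.
have x1 : `|t / s| < 1 by rewrite ger0_norm ?divr_ge0 ?ltW// ltr_pdivrMr// mul1r.
have /cvgrPdist_le/(_ C^-1) := cvg_expr x1; rewrite invr_gt0 => /(_ C0) Ct.
near=> k; have k0 : (0 < k)%N by near: k; exists 1%N.
have Lk : inf E <= q k `^ k%:R^-1 by apply: ge_inf => //; exists k.
rewrite distrC ger0_norm ?subr_ge0// lerBlDl root_le ?(ltW s0)//.
rewrite (le_trans (qC k))// -ler_pdivlMl//.
have : `|0 - (t / s) ^+ k| <= C^-1 by near: k.
rewrite sub0r normrN ger0_norm ?exprn_ge0 ?divr_ge0 ?(ltW t0) ?(ltW s0)//.
by rewrite expr_div_n ler_pdivrMr ?exprn_gt0.
Unshelve. all: by end_near. Qed.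

End real_analysis.

(** * Finite sets of words, graded by length *)

Section words.
Context {R : realType} {T : finType}.
Implicit Types (f : seq T -> R) (k N : nat).

Definition words k : {fset seq T} := [fset tval t | t in [set: k.-tuple T]%SET]%fset.

Lemma in_words k a : (a \in words k) = (size a == k).
Proof.
apply/imfsetP/eqP => [[t _ ->]|ak]; first exact: size_tuple.
by exists (tcast ak (in_tuple a)); rewrite ?inE// val_tcast.
Qed.

Lemma sum_words f k : \sum_(a <- words k) f a = \sum_(t : k.-tuple T) f t.
Proof.
rewrite big_imfset/=; last by move=> ? ? _ _; exact: val_inj.
by rewrite big_enum/=; apply: eq_bigl => t; rewrite inE.
Qed.

Fixpoint words_lt N : {fset seq T} :=
  if N is k.+1 then (words_lt k `|` words k)%fset else fset0.

Lemma in_words_lt N a : (a \in words_lt N) = (size a < N)%N.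
Proof. by elim: N => //= N IH; rewrite in_fsetU IH in_words ltnS [RHS]leq_eqVlt orbC. Qed.

Lemma sum_words_lt f N :
  \sum_(a <- words_lt N) f a = \sum_(k < N) \sum_(t : k.-tuple T) f t.
Proof.
elim: N => [|N IH]; first by rewrite big_ord0 big_seq_fset0.
rewrite big_ord_recr/= -IH -sum_words (big_fset_subset _ (fsubsetUl _ (words N))).
congr (_ + _); apply: eq_fbigl => a; rewrite in_fsetD in_fsetU in_words in_words_lt.
by case: ltngtP.
Qed.

(** A finite set of words lies below the level after its longest word, and the terms are
    nonnegative. Summability can thus be tested level by level. *)
Lemma bounded_level_sums f (M : R) : (forall a, 0 <= f a) ->
  (forall A : {fset seq T}, \sum_(a <- A) f a <= M) <->
  (forall N, \sum_(k < N) \sum_(t : k.-tuple T) f t <= M).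
Proof.
move=> f0; split=> [fM N|fM A]; first by rewrite -sum_words_lt.
apply: le_trans (fM (\max_(a <- A) size a).+1); rewrite -sum_words_lt.
rewrite (@big_fset_subset _ _ f A (words_lt _)) ?lerDl ?sumr_ge0//.
apply/fsubsetP => a aA; rewrite in_words_lt ltnS.
exact: (@leq_bigmax_seq _ _ xpredT size).
Qed.

End words.

Lemma sum_tuple_cons (V : nmodType) (T : finType) k (f : seq T -> V) :
  \sum_(t : k.+1.-tuple T) f t = \sum_(i : T) \sum_(t : k.-tuple T) f (i :: t).
Proof.
rewrite pair_big/= (reindex (fun p : T * k.-tuple T => [tuple of p.1 :: p.2]))//.
exists (fun t : k.+1.-tuple T => (thead t, [tuple of behead t])) => [[i t] _|t _].
  by congr pair; apply: val_inj.
by apply: val_inj; case/tupleP: t.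
Qed.

(** * Euclidean norm and evaluation of words *)

Lemma enorm_ge0 (R : realType) n (lam : 'rV[R[i]]_n) : 0 <= enorm lam.
Proof. exact: sqrtr_ge0. Qed.

Lemma enorm_sqr (R : realType) n (lam : 'rV[R[i]]_n) :
  enorm lam ^+ 2 = \sum_(i < n) rnorm (lam 0 i) ^+ 2.
Proof. by rewrite sqr_sqrtr// sumr_ge0// => i _; exact: sqr_ge0. Qed.

Lemma rnorm_le_enorm (R : realType) n (lam : 'rV[R[i]]_n) i :
  rnorm (lam 0 i) <= enorm lam.
Proof.
rewrite -(@ler_pXn2r _ 2)// ?nnegrE ?enorm_ge0 ?rnorm_ge0// enorm_sqr.
by rewrite (bigD1 i)//= lerDl sumr_ge0// => j _; exact: sqr_ge0.
Qed.

Section word_eval.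
Context {R : realType} {n : nat}.
Implicit Types (lam : 'rV[R[i]]_n) (a : seq 'I_n).

Lemma word_eval_nil lam : word_eval lam [::] = 1.
Proof. by rewrite /word_eval big_nil. Qed.

Lemma word_eval_cons lam i a : word_eval lam (i :: a) = lam 0 i * word_eval lam a.
Proof. by rewrite /word_eval big_cons. Qed.

Lemma word_eval_conj lam a :
  word_eval (map_mx Num.conj lam) a = Num.conj (word_eval lam a).
Proof. by rewrite /word_eval rmorph_prod; apply: eq_bigr => i _; rewrite mxE. Qed.

Lemma word_eval_le_mono lam (zeta : 'rV[R[i]]_n) a :
  (forall i, rnorm (zeta 0 i) <= rnorm (lam 0 i)) ->
  rnorm (word_eval zeta a) <= rnorm (word_eval lam a).
Proof.
move=> zl; rewrite /word_eval !rnorm_prod.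
by apply: ler_prod => i _; rewrite rnorm_ge0 zl.
Qed.

Lemma word_eval_le_enorm lam a : rnorm (word_eval lam a) <= enorm lam ^+ size a.
Proof.
elim: a => [|i a IH]; first by rewrite word_eval_nil (rnormC 1) normr1 expr0.
by rewrite word_eval_cons rnormM exprS ler_pM ?rnorm_ge0// rnorm_le_enorm.
Qed.

(** Noncommutative multinomial expansion, obtained by splitting off the first letter. *)
Lemma sum_word_eval lam k :
  \sum_(a : k.-tuple 'I_n) rnorm (word_eval lam a) ^+ 2 = (enorm lam ^+ 2) ^+ k.
Proof.
elim: k => [|k IH].
  rewrite expr0 (bigD1 [tuple])//= big1 => [|a].
    by rewrite word_eval_nil (rnormC 1) normr1 expr1n addr0.
  by rewrite (tuple0 a) => /negP[].
rewrite (sum_tuple_cons _ (fun a => rnorm (word_eval lam a) ^+ 2)) exprS -IH.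
rewrite {1}enorm_sqr mulr_suml; apply: eq_bigr => i _; rewrite mulr_sumr.
by apply: eq_bigr => a _; rewrite word_eval_cons rnormM exprMn.
Qed.

End word_eval.

(** * Weight products along words *)

Section weights.
Context {R : realType} {n : nat}.
Variable mu : seq 'I_n -> R.
Hypothesis mu_gt0 : forall a : seq 'I_n, (1 <= size a)%N -> 0 < mu a.
Implicit Types (lam : 'rV[R[i]]_n) (a b : seq 'I_n).

Lemma weight_prod_gt0 a : 0 < weight_prod mu a.
Proof. by elim: a => //= i a IH; rewrite mulr_gt0// mu_gt0. Qed.

Lemma weight_prod_neq0 a : (weight_prod mu a)%:C != 0.
Proof. by rewrite (fmorph_eq0 (real_complex R)) gt_eqF// weight_prod_gt0. Qed.

Lemma weight_prod_le (r : R) a : (forall b, (1 <= size b)%N -> mu b <= r) ->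
  weight_prod mu a <= r ^+ size a.
Proof.
move=> mur; elim: a => //= i a IH; rewrite exprS ler_pM ?mur//.
  by rewrite ltW// mu_gt0.
by rewrite ltW// weight_prod_gt0.
Qed.

Lemma weight_prod_ge (r : R) a : 0 <= r ->
  (forall b, (1 <= size b)%N -> r <= mu b) -> r ^+ size a <= weight_prod mu a.
Proof.
move=> r0 mur; elim: a => //= i a IH.
by rewrite exprS ler_pM ?mur// exprn_ge0.
Qed.

(* The diagonal entry at b of the sum of W_a W_a^* over the words a of length k:
   the only a that contributes is the prefix of b of length k. *)
Definition window k b : R :=
  if (k <= size b)%N then (weight_prod mu b / weight_prod mu (drop k b)) ^+ 2 else 0.

Lemma window_ge0 k b : 0 <= window k b.
Proof. by rewrite /window; case: ifP => // _; exact: sqr_ge0. Qed.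

(** The quotients of weight products telescope when letters are removed in two stages; if [b] is too
    short, both sides vanish. Submultiplicativity of the suprema comes from here. *)
Lemma windowD k l b : window (k + l) b = window k b * window l (drop k b).
Proof.
rewrite /window size_drop drop_drop [(l + k)%N]addnC; have [kb|bk] := leqP k (size b).
  rewrite leq_subRL//; case: ifP => // _; last by rewrite mulr0.
  by rewrite -exprMn mulrA divfK// gt_eqF// weight_prod_gt0.
by rewrite mul0r leqNgt (leq_trans bk)// leq_addr.
Qed.

Lemma window1 b : (1 <= size b)%N -> window 1 b = mu b ^+ 2.
Proof.
case: b => // i b _; rewrite /window /= drop0 mulfK// gt_eqF//.
exact: weight_prod_gt0.
Qed.

Lemma window_le (M : R) k b : (forall b, (1 <= size b)%N -> mu b <= M) ->
  0 <= M -> window k b <= (M ^+ 2) ^+ k.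
Proof.
move=> muM M0; elim: k b => [|k IH] b.
  by rewrite expr0 /window drop0 divff ?expr1n// gt_eqF// weight_prod_gt0.
rewrite -[k.+1]add1n windowD exprD expr1 ler_pM ?window_ge0//.
have [b0|] := leqP 1 (size b); last first.
  by rewrite /window ltnNge => /negbTE ->; exact: sqr_ge0.
by rewrite window1// lerXn2r ?nnegrE// ?muM// ltW// mu_gt0.
Qed.

(** Coefficient of [eigenseries] without its basis vector, so that [square_summable] applies. *)
Definition eigencoef lam a : R[i] :=
  Num.conj (word_eval lam a) / (weight_prod mu a)%:C.

Lemma rnorm_eigencoef lam a :
  rnorm (eigencoef lam a) ^+ 2 = rnorm (word_eval lam a) ^+ 2 / weight_prod mu a ^+ 2.
Proof.
rewrite /eigencoef rnormM rnormJ rnormV rnormC ger0_norm ?exprMn ?exprVn//.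
by rewrite ltW// weight_prod_gt0.
Qed.

End weights.

(** * Adjoints of the shift and its joint eigenvectors *)

Section shift.
Context {R : realType} {n : nat} {H : hilbertType R} {e : seq 'I_n -> H}.
Context {mu : seq 'I_n -> R} {W : 'I_n -> {linear H -> H}}.
Hypothesis he : orthonormal_basis e.
Hypothesis mu_gt0 : forall a : seq 'I_n, (1 <= size a)%N -> 0 < mu a.
Hypothesis hW : weighted_shift e mu W.
Implicit Types (lam : 'rV[R[i]]_n) (a b : seq 'I_n) (x y z : H).

Local Notation Wop := (word_op (fun i => W i)).
Let Wstar i := adjoint (W i).

Lemma shift_adjoint i : is_adjoint (W i) (Wstar i).
Proof. exact: (bounded_adjoint he (hW.1 i)). Qed.

(** Composing the [Wstar i] in reverse order gives an adjoint, and by [adjointE] any adjoint will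
    do. *)
Lemma word_adjoint a :
  is_adjoint (Wop a) (adjoint (Wop a)).
Proof.
suff [S aS] : exists S, is_adjoint (Wop a) S by rewrite (adjointE aS).
elim: a => [|i a [S aS]]; first by exists id.
by exists (S \o Wstar i) => x y /=; rewrite shift_adjoint aS.
Qed.

Lemma word_op_basis a b : Wop a (e b) =
  (weight_prod mu (a ++ b) / weight_prod mu b)%:C *: e (a ++ b).
Proof.
have wb := gt_eqF (weight_prod_gt0 mu_gt0 b).
elim: a => /= [|i a ->]; first by rewrite divff ?wb// scale1r.
by rewrite linearZ/= hW.2 scalerA -rmorphM/= mulrC mulrA.
Qed.

(** The adjoint sends [e b] to 0 unless [a] is a prefix of [b], and otherwise to a multiple of
    [e c0], with [c0] the rest of [b]. Going back from [e c0] to [e b] brings the same factor again,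
    hence the square. *)
Lemma word_diag a x b :
  inner (Wop a (adjoint (Wop a) x)) (e b) =
  (if take (size a) b == a then window mu (size a) b else 0)%:C * inner x (e b).
Proof.
have Wa := word_adjoint a; set S := adjoint _ in Wa *; rewrite Wa.
have Se c : inner (S (e b)) (e c) =
    (weight_prod mu (a ++ c) / weight_prod mu c)%:C * (b == a ++ c)%:R.
  by rewrite innerC -Wa word_op_basis innerZl rmorphM/= conjC_real -innerC coef_basis.
case: ifPn => [/eqP ta|ta]; last first.
  have -> : S (e b) = 0.
    apply: (coef_inj he) => c; rewrite Se inner0l; case: eqVneq => [bE|_].
      by rewrite bE take_size_cat// eqxx in ta.
    by rewrite mulr0.
  by rewrite mul0r innerC inner0l rmorph0.
have ab : (size a <= size b)%N by rewrite -{1}ta size_take; case: ltnP => // /ltnW.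
have bE : b = a ++ drop (size a) b by rewrite -{1}(cat_take_drop (size a) b) ta.
set c0 := drop (size a) b in bE.
have -> : S (e b) = (weight_prod mu b / weight_prod mu c0)%:C *: e c0.
  apply: (coef_inj he) => c; rewrite Se innerZl (coef_basis he) {1 2}bE.
  have [->|cc0] := eqVneq c0 c; first by rewrite eqxx.
  by rewrite eqseq_cat// eqxx/= (negbTE cc0) !mulr0.
rewrite innerZr conjC_real innerC -Wa word_op_basis -bE; set w := _ / _.
rewrite innerZl [X in w%:C * X]rmorphM/= conjC_real -innerC mulrA.
by rewrite -rmorphM/= /window ab expr2.
Qed.

Lemma words_diag k x b :
  inner (\sum_(a : k.-tuple 'I_n)
    Wop a (adjoint (Wop a) x)) (e b) =
  (window mu k b)%:C * inner x (e b).
Proof.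
rewrite inner_suml; under eq_bigr do rewrite word_diag size_tuple.
rewrite -mulr_suml -rmorph_sum/=; congr (_%:C * _).
have [kb|bk] := leqP k (size b); last first.
  have -> : window mu k b = 0 by rewrite /window leqNgt bk.
  by rewrite big1// => a _; case: ifP.
have tk : size (take k b) == k by rewrite size_takel.
rewrite (bigD1 (Tuple tk))//= eqxx big1 ?addr0// => a ak.
by case: eqP => // E; case/negP: ak; apply/eqP/val_inj.
Qed.

Lemma row_diag x b :
  inner (\sum_(i < n) W i (Wstar i x)) (e b) = (window mu 1 b)%:C * inner x (e b).
Proof.
rewrite inner_suml; under eq_bigr => i _ do rewrite (word_diag [:: i]).
rewrite -mulr_suml -rmorph_sum/=; congr (_%:C * _).
case: b => [|j b]; first by rewrite big1.
rewrite (bigD1 j)//= take0 eqxx big1 ?addr0// => i ij.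
by rewrite eqseq_cons eq_sym (negbTE ij).
Qed.

Lemma adjoint_coef i z b :
  inner (Wstar i z) (e b) = (mu (i :: b))%:C * inner z (e (i :: b)).
Proof.
by rewrite innerC -shift_adjoint hW.2 innerZl rmorphM/= conjC_real -innerC.
Qed.

(** The vacuum [e [::]] is annihilated by every [Wstar i], because no word [i :: b] is empty. *)
Lemma point_spectrum0 : joint_point_spectrum Wstar 0.
Proof.
exists (e [::]); split; first by rewrite -rnorm_gt0 (rnorm_basis he).
move=> i; apply: (coef_inj he) => b.
by rewrite adjoint_coef (coef_basis he) mulr0 mxE scale0r inner0l.
Qed.

Lemma eigenvector_coef lam z : joint_eigenvector_at Wstar lam z ->
  forall b, inner z (e b) = word_eval lam b / (weight_prod mu b)%:C * inner z (e [::]).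
Proof.
move=> [_ Wz]; elim=> [|i b IH]; first by rewrite word_eval_nil divr1 mul1r.
have m0 : (mu (i :: b))%:C != 0.
  by rewrite (fmorph_eq0 (real_complex R)) gt_eqF// mu_gt0.
apply: (mulfI m0); rewrite -adjoint_coef Wz innerZl IH word_eval_cons /=.
rewrite [(mu _ * _)%:C]rmorphM/=.
have := weight_prod_neq0 mu_gt0 b; move: (_%:C) (_%:C) m0 => m p m0 p0.
by field; rewrite m0 p0.
Qed.

Lemma coef_eigenvec lam b : square_summable (eigencoef mu lam) ->
  inner (eigenvec e mu lam) (e b) = eigencoef mu lam b.
Proof. exact: (coef_basis_sum he). Qed.

Lemma adjoint_eigenvec lam i : square_summable (eigencoef mu lam) ->
  Wstar i (eigenvec e mu lam) = Num.conj (lam 0 i) *: eigenvec e mu lam.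
Proof.
move=> ls; apply: (coef_inj he) => b.
rewrite adjoint_coef innerZl !coef_eigenvec// /eigencoef word_eval_cons /=.
have m0 : (mu (i :: b))%:C != 0.
  by rewrite (fmorph_eq0 (real_complex R)) gt_eqF// mu_gt0.
rewrite !rmorphM/=; have := weight_prod_neq0 mu_gt0 b.
move: (mu _)%:C (weight_prod _ _)%:C m0 => m p m0 p0.
by field; rewrite m0 p0.
Qed.

Lemma eigenvec_neq0 lam : square_summable (eigencoef mu lam) ->
  eigenvec e mu lam != 0.
Proof.
move=> ls; apply/eqP => z0; have := coef_eigenvec [::] ls.
rewrite z0 inner0l /eigencoef word_eval_nil rmorph1 divr1 => /eqP.
by rewrite eq_sym oner_eq0.
Qed.

(** The condition sees only moduli. This reconciles the eigenvalue of [eigenvec e mu lam], which is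
    the conjugate of [lam], with a criterion stated at [lam] itself. *)
Lemma square_summable_conj lam : square_summable (eigencoef mu lam) ->
  square_summable (eigencoef mu (map_mx Num.conj lam)).
Proof.
apply: square_summable_sub => a.
by rewrite /eigencoef !rnormM !rnormJ word_eval_conj rnormJ.
Qed.

Lemma map_conjK lam : map_mx Num.conj (map_mx Num.conj lam) = lam.
Proof. by apply/rowP => i; rewrite !mxE conjCK. Qed.

Lemma eigenvec_conj_at lam : square_summable (eigencoef mu lam) ->
  joint_eigenvector_at Wstar (map_mx Num.conj lam) (eigenvec e mu lam).
Proof.
move=> ls; split; first exact: eigenvec_neq0.
by move=> i; rewrite adjoint_eigenvec// mxE.
Qed.

Lemma point_spectrumP lam :
  joint_point_spectrum Wstar lam <-> square_summable (eigencoef mu lam).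
Proof.
split=> [[z zl]|ls]; last first.
  exists (eigenvec e mu (map_mx Num.conj lam)); rewrite -{1}(map_conjK lam).
  exact: eigenvec_conj_at (square_summable_conj ls).
have zE := eigenvector_coef zl; set z0 := inner z (e [::]) in zE.
(* If the coefficient at the empty word vanished, all coefficients would. Bessel's inequality for
   [z] can then be divided by [|z0|^2]. *)
have z00 : 0 < rnorm z0 ^+ 2.
  rewrite exprn_gt0// rnorm_gt0; apply/eqP => z0E; case/negP: zl.1; apply/eqP.
  by apply: (coef_inj he) => b; rewrite zE z0E mulr0 inner0l.
exists (rnorm z ^+ 2 / rnorm z0 ^+ 2) => A; rewrite ler_pdivlMr// mulr_suml.
apply: le_trans (bessel he A z); apply: ler_sum => a _.
by rewrite zE -exprMn -rnormM /eigencoef !rnormM rnormJ.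
Qed.

Lemma eigenvectorP z : joint_eigenvector Wstar z <->
  exists lam (c : R[i]),
    [/\ joint_point_spectrum Wstar lam, c != 0 & z = c *: eigenvec e mu lam].
Proof.
split=> [[zeta zl]|[lam [c [/point_spectrumP ls c0 ->]]]]; last first.
  have [z0 Wz] := eigenvec_conj_at ls.
  exists (map_mx Num.conj lam); split; first by rewrite scaler_eq0 negb_or c0.
  (* Homogeneity of [Wstar i] is checked on coefficients, as [adjoint] is a bare function. *)
  move=> i; apply: (coef_inj he) => b.
  rewrite adjoint_coef !innerZl mulrCA -adjoint_coef Wz innerZl.
  by rewrite mulrCA.
have zetas : square_summable (eigencoef mu zeta) by apply/point_spectrumP; exists z.
have ls := square_summable_conj zetas.
have zE := eigenvector_coef zl.
(* The scalar is read off at the empty word, where [eigenvec] has coefficient 1. *)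
exists (map_mx Num.conj zeta), (inner z (e [::])); split; first exact/point_spectrumP.
  apply/eqP => z0E; case/negP: zl.1; apply/eqP.
  by apply: (coef_inj he) => b; rewrite zE z0E mulr0 inner0l.
apply: (coef_inj he) => b; rewrite zE innerZl coef_eigenvec// /eigencoef.
by rewrite word_eval_conj conjCK mulrC.
Qed.

Lemma adjoint_word_eigenvector lam z a : joint_eigenvector_at Wstar lam z ->
  adjoint (Wop a) z = word_eval lam a *: z.
Proof.
move=> [_ Wz]; apply: inner_ext => x; rewrite -word_adjoint.
elim: a => [|i a IH]; first by rewrite word_eval_nil scale1r.
rewrite /= shift_adjoint Wz innerZr -/(Wop _) IH word_eval_cons.
by rewrite !innerZr rmorphM mulrA.
Qed.

(** * Row norm and joint spectral radius *)

Variable M : R.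
Hypothesis muM : forall b, (1 <= size b)%N -> mu b <= M.
Hypothesis M0 : 0 <= M.

Let s k := sup (range (window mu k)).

Lemma window_le_sup k b : window mu k b <= s k.
Proof. exact: (diagonal_le_sup (fun b => window_le mu_gt0 k b muM M0)). Qed.

Lemma sup_window_ge0 k : 0 <= s k.
Proof. exact: le_trans (window_ge0 _ _ _) (window_le_sup k [::]). Qed.

Lemma sup_windowD k l : s (k + l)%N <= s k * s l.
Proof.
apply: ge_sup; first by exists (window mu (k + l) [::]), [::].
move=> _ [b _ <-]; rewrite windowD//.
by apply: ler_pM; rewrite ?window_ge0 ?window_le_sup.
Qed.

Lemma opnorm_words k : opnorm (fun x => \sum_(a : k.-tuple 'I_n)
    Wop a (adjoint (Wop a) x)) = s k.
Proof.
exact: (diagonal_opnorm he (window_ge0 mu k)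
  (fun b => window_le mu_gt0 k b muM M0) (words_diag k) [::]).
Qed.

Lemma row_normE : row_norm (fun i => W i) = Num.sqrt (s 1).
Proof.
congr Num.sqrt; exact: (diagonal_opnorm he (window_ge0 mu 1)
  (fun b => window_le mu_gt0 1 b muM M0) row_diag [::]).
Qed.

(** The squared weights are diagonal entries of the sum of the [W_i W_i^*]. In part (iii) this
    bounds all weights by the norm of [lam]. *)
Lemma weight_le_row_norm b : (1 <= size b)%N -> mu b <= row_norm (fun i => W i).
Proof.
move=> b1; rewrite row_normE -[leLHS]ger0_norm ?(ltW (mu_gt0 b1))// -sqrtr_sqr.
by rewrite ler_wsqrtr// -window1// window_le_sup.
Qed.

(** Ensures that the [limn] defining the spectral radius is a genuine limit: the square roots of the
    [s k] stay submultiplicative. *)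
Lemma spectral_radius_cvg : cvgn (fun k : nat => Num.sqrt (s k) `^ k%:R^-1).
Proof.
apply: submultiplicative_root_cvg => [k|k l]; first exact: sqrtr_ge0.
by rewrite -sqrtrM ?sup_window_ge0// ler_wsqrtr// sup_windowD.
Qed.

Lemma joint_spectral_radiusE :
  joint_spectral_radius (fun i => W i) = limn (fun k : nat => Num.sqrt (s k) `^ k%:R^-1).
Proof.
rewrite /joint_spectral_radius; congr (limn _); apply/funext => k.
by rewrite opnorm_words natrM invfM powRrM powR12_sqrt// sup_window_ge0.
Qed.

(* Pairing the sum of the W_a W_a^* z with the eigenvector z gives
   |lam|^(2k) |z|^2. *)
Lemma enorm_le_spectral lam k : joint_point_spectrum Wstar lam ->
  (enorm lam ^+ 2) ^+ k <= s k.
Proof.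
move=> [z zl]; pose T x := \sum_(a : k.-tuple 'I_n)
    Wop a (adjoint (Wop a) x).
have z0 : 0 < rnorm z by rewrite rnorm_gt0 zl.1.
have Tz : inner (T z) z = ((enorm lam ^+ 2) ^+ k * rnorm z ^+ 2)%:C.
  rewrite inner_suml -sum_word_eval mulr_suml rmorph_sum/=; apply: eq_bigr => a _.
  rewrite word_adjoint (adjoint_word_eigenvector _ zl) inner_rnorm rnormZ.
  by rewrite exprMn.
have Tb := diagonal_bound he (window_ge0 mu k)
  (fun b => window_le mu_gt0 k b muM M0) (words_diag k) z.
rewrite -(ler_pM2r (exprn_gt0 2 z0)).
rewrite -[leLHS]ger0_norm ?mulr_ge0 ?exprn_ge0 ?enorm_ge0 ?rnorm_ge0//.
rewrite -rnormC -Tz (le_trans (cauchy_schwarz _ _))// expr2 mulrA.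
by rewrite ler_wpM2r ?rnorm_ge0.
Qed.

Lemma enorm_le_spectral_radius lam : joint_point_spectrum Wstar lam ->
  enorm lam <= joint_spectral_radius (fun i => W i).
Proof.
move=> ls; rewrite joint_spectral_radiusE; apply: limr_ge.
  exact: spectral_radius_cvg.
(* At [k = 0] the exponent is 0 and the root carries no information. *)
near=> k; have k0 : (0 < k)%N by near: k; exists 1%N.
rewrite -[leLHS](root_expr (enorm_ge0 lam) k0).
apply: ge0_ler_powR; rewrite ?invr_ge0 ?ler0n ?nnegrE ?exprn_ge0 ?enorm_ge0 ?sqrtr_ge0//.
rewrite -[leLHS]ger0_norm ?exprn_ge0 ?enorm_ge0// -sqrtr_sqr ler_wsqrtr//.
by rewrite exprAC enorm_le_spectral.
Unshelve. all: by end_near. Qed.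

End shift.

(** * Weight growth, balls and spheres *)

Section growth.
Context {R : realType} {n : nat}.
Variable mu : seq 'I_n -> R.
Hypothesis mu_gt0 : forall a : seq 'I_n, (1 <= size a)%N -> 0 < mu a.
Implicit Types (lam : 'rV[R[i]]_n).

Let S k := \sum_(a : k.-tuple 'I_n) (weight_prod mu a ^+ 2)^-1.

Lemma level_ge0 k : 0 <= S k.
Proof. by apply: sumr_ge0 => a _; rewrite invr_ge0 sqr_ge0. Qed.

Lemma eigencoef_level_sums lam : square_summable (eigencoef mu lam) <->
  exists K : R, forall N,
    \sum_(k < N) \sum_(a : k.-tuple 'I_n) rnorm (eigencoef mu lam a) ^+ 2 <= K.
Proof.
have f0 a : 0 <= rnorm (eigencoef mu lam a) ^+ 2 by exact: sqr_ge0.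
by split=> -[K lK]; exists K; apply/(bounded_level_sums K f0).
Qed.

Lemma weight_growth_geometric (K L : R) : 1 <= K -> 0 <= L ->
  (forall k, S k <= K * L ^+ k) -> (weight_growth mu < +oo)%E.
Proof.
move=> K1 L0 SKL; have K0 : 0 <= K by rewrite (le_trans ler01).
(* The summand 1 covers [k = 0], where the exponent is 0 and the power is 1; for [k > 0] the root is
   at most [K * L] because [K >= 1]. *)
apply: (@limn_esup_le _ _ (1 + K * L)) => -[|k].
  by rewrite invr0 powRr0 lerDl mulr_ge0.
rewrite root_le ?level_ge0 ?addr_ge0 ?mulr_ge0// (le_trans (SKL _))//.
apply: (@le_trans _ _ ((K * L) ^+ k.+1)).
  by rewrite exprMn ler_wpM2r ?exprn_ge0// ler_eXnr.
by rewrite lerXn2r ?nnegrE ?addr_ge0 ?mulr_ge0// lerDr.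
Qed.

(** There are [n ^ k] words of length [k], each contributing at most [c ^ (-2k)]. *)
Lemma weight_growth_bounded_below (c : R) : 0 < c ->
  (forall a : seq 'I_n, (1 <= size a)%N -> c <= mu a) ->
  (weight_growth mu < +oo)%E.
Proof.
move=> c0 cmu; apply: (@weight_growth_geometric 1 (n%:R * (c ^+ 2)^-1)) => //.
  by rewrite mulr_ge0// invr_ge0 sqr_ge0.
move=> k; rewrite mul1r exprMn.
apply: (@le_trans _ _ (\sum_(a : k.-tuple 'I_n) ((c ^+ 2)^-1) ^+ k)).
  apply: ler_sum => a _; rewrite exprVn exprAC.
  rewrite lef_pV2 ?posrE ?exprn_gt0 ?weight_prod_gt0//.
  rewrite lerXn2r ?nnegrE ?exprn_ge0 ?(ltW c0) ?(ltW (weight_prod_gt0 _ _))//.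
  by rewrite -[X in _ ^+ X <= _](size_tuple a) weight_prod_ge// ltW.
by rewrite sumr_const card_tuple card_ord -[leLHS]mulr_natl natrX.
Qed.

Lemma enorm_const (t : R) : 0 <= t ->
  enorm (const_mx t%:C : 'rV[R[i]]_n) ^+ 2 = n%:R * t ^+ 2.
Proof.
move=> t0; rewrite enorm_sqr (eq_bigr (fun=> t ^+ 2)) => [|i _].
  by rewrite sumr_const card_ord mulr_natl.
by rewrite mxE rnormC ger0_norm.
Qed.

Lemma rnorm_word_eval_const (t : R) a : 0 <= t ->
  rnorm (word_eval (const_mx t%:C : 'rV[R[i]]_n) a) = t ^+ size a.
Proof.
move=> t0; elim: a => [|i a IH]; first by rewrite word_eval_nil (rnormC 1) normr1.
by rewrite word_eval_cons rnormM IH mxE rnormC ger0_norm// exprS.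
Qed.

(** At a constant tuple [t] the level sums are [S k * t ^ (2k)]; being bounded, they force geometric
    growth of [S]. *)
Lemma growth_of_ball (r : R) : 0 < r ->
  (forall lam, enorm lam < r -> square_summable (eigencoef mu lam)) ->
  (weight_growth mu < +oo)%E.
Proof.
(* The constant tuple has norm [t] times the square root of [n], which is below [t * n.+1 = r]. *)
move=> r0 rsum; pose t := r / n.+1%:R; have t0 : 0 < t by rewrite divr_gt0.
have tr : enorm (const_mx t%:C : 'rV[R[i]]_n) < r.
  rewrite -(@ltr_pXn2r _ 2)// ?nnegrE ?enorm_ge0 ?(ltW r0)// enorm_const ?(ltW t0)//.
  have -> : r ^+ 2 = t ^+ 2 * n.+1%:R ^+ 2 by rewrite -exprMn divfK ?pnatr_eq0.
  rewrite mulrC ltr_pM2l ?exprn_gt0// (@lt_le_trans _ _ n.+1%:R) ?ltr_nat//.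
  by rewrite -natrX ler_nat leq_pmulr.
have /eigencoef_level_sums[K lK] := rsum _ tr.
have level k : S k * (t ^+ 2) ^+ k <= Num.max K 1.
  rewrite le_max; apply/orP; left; apply: le_trans (lK k.+1).
  rewrite big_ord_recr/= -[leLHS]add0r lerD//.
    by apply: sumr_ge0 => j _; apply: sumr_ge0 => a _; exact: sqr_ge0.
  rewrite mulr_suml ler_sum// => a _; rewrite rnorm_eigencoef//.
  by rewrite rnorm_word_eval_const ?(ltW t0)// size_tuple mulrC exprAC.
apply: (@weight_growth_geometric (Num.max K 1) (t ^+ 2)^-1).
- by rewrite le_max lexx orbT.
- by rewrite invr_ge0 sqr_ge0.
- by move=> k; rewrite exprVn ler_pdivlMr// ?exprn_gt0.
Qed.

Lemma ball_of_growth : (weight_growth mu < +oo)%E ->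
  exists2 r : R, 0 < r &
    forall lam, enorm lam < r -> square_summable (eigencoef mu lam).
Proof.
move=> /limn_esup_lty[L [N SL]].
have L0 : 0 <= L by exact: le_trans (powR_ge0 _ _) (SL N (leqnn N)).
have L1 : 0 < 2 * (L + 1) by rewrite mulr_gt0// ltr_wpDl.
(* With this radius [r ^+ 2 * L <= 1/2], so the levels beyond [N] are dominated by a geometric
   series of ratio 1/2, with sum at most 2. *)
pose r := Num.sqrt (2 * (L + 1))^-1; have r0 : 0 < r by rewrite sqrtr_gt0 invr_gt0.
exists r => // lam lr; apply/eigencoef_level_sums.
pose g k := \sum_(a : k.-tuple 'I_n) rnorm (eigencoef mu lam a) ^+ 2.
have g0 k : 0 <= g k by apply: sumr_ge0 => a _; exact: sqr_ge0.
have gS k : g k <= (r ^+ 2) ^+ k * S k.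
  rewrite mulr_sumr ler_sum// => a _; rewrite rnorm_eigencoef//.
  rewrite ler_wpM2r ?invr_ge0 ?sqr_ge0// exprAC.
  rewrite lerXn2r ?nnegrE ?rnorm_ge0 ?exprn_ge0 ?(ltW r0)//.
  rewrite (le_trans (word_eval_le_enorm _ _))// size_tuple.
  by rewrite lerXn2r ?nnegrE ?enorm_ge0 ?(ltW r0)// ltW.
have ghalf k : (N < k)%N -> g k <= (2^-1) ^+ k.
  move=> Nk; have k0 : (0 < k)%N by exact: leq_ltn_trans Nk.
  apply: (le_trans (gS k)); have := SL k (ltnW Nk).
  rewrite root_le ?level_ge0// => SLk.
  rewrite (le_trans (ler_wpM2l _ SLk)) ?exprn_ge0 ?(ltW r0)//.
  rewrite -exprMn lerXn2r ?nnegrE ?mulr_ge0 ?sqr_ge0 ?invr_ge0 ?(ltW r0)//.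
  rewrite sqr_sqrtr ?invr_ge0 ?(ltW L1)// ler_pdivrMl// mulrAC divff ?pnatr_eq0//.
  by rewrite mul1r lerDl.
exists (\sum_(k < N.+1) g k + 2) => K.
(* Lengthening the sum lets the first [N.+1] levels split off exactly. *)
apply: (@le_trans _ _ (\sum_(k < N.+1 + K) g k)).
  rewrite -!(big_mkord xpredT g) (@big_cat_nat _ _ _ K 0 (N.+1 + K))//= ?leq_addl//.
  by rewrite lerDl sumr_ge0.
rewrite big_split_ord lerD2l/=.
apply: (@le_trans _ _ (\sum_(j < K) (2^-1) ^+ j)).
  apply: ler_sum => j _; rewrite (le_trans (ghalf _ _)) ?addSn ?ltnS ?leq_addr//.
  rewrite -addSn exprD ler_piMl ?exprn_ge0 ?invr_ge0//.
  by rewrite exprn_ile1 ?invr_ge0// invf_le1// ler1n.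
have h1 : 1 - 2^-1 = 2^-1 :> R by field.
rewrite -(ler_pM2l (_ : 0 < 1 - 2^-1)) ?h1 ?invr_gt0//.
have := subrX1 (2^-1 : R) K => /(congr1 -%R); rewrite opprB -mulNr opprB h1 => <-.
by rewrite mulVf// lerBlDr lerDl exprn_ge0// invr_ge0.
Qed.

(* Every level contributes at least 1, so the partial sums are unbounded. *)
Lemma not_summable_sphere (rho : R) lam : 0 < rho -> enorm lam = rho ->
  (forall a : seq 'I_n, (1 <= size a)%N -> mu a <= rho) ->
  ~ square_summable (eigencoef mu lam).
Proof.
move=> rho0 lrho mur /eigencoef_level_sums[K lK].
(* The weight products are at most [rho ^+ k], while the [|lam_a|^2] add up to [rho ^ (2k)]. *)
have level k : 1 <= \sum_(a : k.-tuple 'I_n) rnorm (eigencoef mu lam a) ^+ 2.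
  rewrite -(@divff _ ((rho ^+ 2) ^+ k)) ?gt_eqF ?exprn_gt0//.
  rewrite -{1}lrho -sum_word_eval mulr_suml ler_sum// => a _.
  rewrite rnorm_eigencoef// ler_wpM2l ?sqr_ge0//.
  rewrite lef_pV2 ?posrE ?exprn_gt0 ?weight_prod_gt0// exprAC.
  rewrite lerXn2r ?nnegrE ?exprn_ge0 ?(ltW rho0) ?(ltW (weight_prod_gt0 _ _))//.
  by rewrite -[X in _ <= _ ^+ X](size_tuple a) weight_prod_le.
have K0 : 0 <= K by have := lK 0%N; rewrite big_ord0.
have := le_trans (ler_sum _ (fun (k : 'I_(Num.bound K)) _ => level k)) (lK _).
by rewrite sumr_const card_ord leNgt archi_boundP.
Qed.

End growth.

(** * The four statements assembled *)

Theorem proposition4p9 (R : realType) (n : nat) (hn : (0 < n)%N)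
    (H : hilbertType R) (e : seq 'I_n -> H) (he : orthonormal_basis e)
    (mu : seq 'I_n -> R)
    (mu_gt0 : forall a : seq 'I_n, (1 <= size a)%N -> 0 < mu a)
    (mu_bounded : forall i : 'I_n,
      exists M : R, forall a : seq 'I_n, mu (i :: a) <= M)
    (W : 'I_n -> {linear H -> H}) (hW : weighted_shift e mu W) :
  let Wstar := fun i : 'I_n => adjoint (W i) in
  let sigma := joint_point_spectrum Wstar in
  (* (i) *)
  (sigma = [set lam : 'rV[R[i]]_n |
     (\esum_(a in [set: seq 'I_n])
       (rnorm (word_eval lam a) ^+ 2 / weight_prod mu a ^+ 2)%:E < +oo)%E] /\
   (forall lam : 'rV[R[i]]_n, sigma lam ->
     cvg (summability.partial_sum (eigenseries e mu lam)
            @ summability.totally)) /\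
   (forall z : H, joint_eigenvector Wstar z <->
     exists (lam : 'rV[R[i]]_n) (c : R[i]),
       [/\ sigma lam, c != 0 & z = c *: eigenvec e mu lam]) /\
   (forall lam : 'rV[R[i]]_n, sigma lam -> forall i : 'I_n,
     Wstar i (eigenvec e mu lam) =
       Num.conj (lam 0 i) *: eigenvec e mu lam)) /\
  (* (ii) *)
  (complete_Reinhardt sigma /\ sigma 0 /\
   sigma `<=` [set lam : 'rV[R[i]]_n | enorm lam <= joint_spectral_radius W])
  /\
  (* (iii) *)
  (forall lam : 'rV[R[i]]_n, enorm lam = row_norm W -> ~ sigma lam) /\
  (* (iv) *)
  (((exists2 r : R, 0 < r & [set lam : 'rV[R[i]]_n | enorm lam < r] `<=` sigma)
     <-> (weight_growth mu < +oo)%E) /\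
   ((exists2 c : R, 0 < c &
       forall a : seq 'I_n, (1 <= size a)%N -> c <= mu a) ->
     (weight_growth mu < +oo)%E)).
Proof.
move=> Wstar sigma.
have sigmaP lam : sigma lam <-> square_summable (eigencoef mu lam).
  exact: (point_spectrumP he mu_gt0 hW).
have [M M0 muM] : exists2 M : R, 0 <= M & forall a, (1 <= size a)%N -> mu a <= M.
  have /choice[M_ M_mu] := mu_bounded.
  (* Summing over the finitely many generators gives one nonnegative bound for all weights. *)
  exists (\sum_i `|M_ i|) => [|[//|i a] _]; first exact: sumr_ge0.
  rewrite (le_trans (M_mu i a))// (le_trans (ler_norm _))// (bigD1 i)//=.
  by rewrite lerDl sumr_ge0.
split; last split; last split; last split.
- split.
    apply/seteqP; split=> lam /=.
      move=> /sigmaP[K lK]; apply/esum_ltyP => [a|].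
        by rewrite divr_ge0// sqr_ge0.
      exists K => A; apply: le_trans (lK A); apply: ler_sum => a _.
      by rewrite rnorm_eigencoef.
    move=> /esum_ltyP[a|K lK]; first by rewrite divr_ge0// sqr_ge0.
    apply/sigmaP; exists K => A; apply: le_trans (lK A); apply: ler_sum => a _.
    by rewrite rnorm_eigencoef.
  split; first by move=> lam /sigmaP; exact: riesz_fischer.
  split; first exact: eigenvectorP.
  by move=> lam /sigmaP ls i; exact: adjoint_eigenvec.
- split.
    move=> lam zeta /sigmaP ls zl; apply/sigmaP; apply: square_summable_sub ls => a.
    rewrite /eigencoef !rnormM !rnormJ ler_wpM2r ?rnorm_ge0//.
    by apply: word_eval_le_mono => i; exact: zl.
  split; first exact: (point_spectrum0 he hW).
  by move=> lam; exact: (enorm_le_spectral_radius he mu_gt0 hW muM M0).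
- move=> lam lW /sigmaP; apply: (not_summable_sphere mu_gt0 _ lW).
    (* A one-letter word, available since [n > 0], shows that the row norm is positive. *)
    apply: (@lt_le_trans _ _ (mu [:: Ordinal hn])); first exact: mu_gt0.
    exact: (weight_le_row_norm he mu_gt0 hW muM M0).
  by move=> a; exact: (weight_le_row_norm he mu_gt0 hW muM M0).
- split=> [[r r0 rs]|/(ball_of_growth mu_gt0)[r r0 rs]].
    by apply: (growth_of_ball mu_gt0 r0) => lam lr; apply/sigmaP/rs.
  by exists r => // lam lr; apply/sigmaP/rs.
- by move=> [c c0 cmu]; exact: weight_growth_bounded_below c0 cmu.
Qed.
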